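(* For every integer $n\ge 2$, let $c_n$ be the universal constant which is the coefficient of $\operatorname{Tr}\{\mathcal{J}_{n-2}(\xi)\}$ in the universal expression $$\mathcal{H}_n(\xi)=c_n\operatorname{Tr}\{\mathcal{J}_{n-2}(\xi)\}+\text{lower order terms}$$ for the $n$-th coefficient of the asymptotic expansion of the volume density function of a Riemannian manifold in geodesic coordinates. Then $$c_n=-\frac{n-1}{(n+1)!}\,.$$
   Context: Let $\mathcal{M}=(M,g)$ be a Riemannian manifold of dimension $m\ge 2$ and let $P\in M$. Let $\xi=(\xi^1,\dots,\xi^m)$ be geodesic (normal) coordinates centered at $P$, defined by the exponential map and an orthonormal frame of $T_PM$; $\xi$ is also regarded as an element of $T_PM$. Let $\tilde\Theta_P(\xi):=\sqrt{\det(g_{ij}(\xi))}$ and $\Theta_P(\xi):=\|\xi\|^{m-1}\tilde\Theta_P(\xi)$ be the volume density functions. Expand about the origin $$\Theta_P(\xi)\sim\|\xi\|^{m-1}\Big(1+\sum_{k=2}^\infty\mathcal{H}_k(\xi)\Big),\qquad \mathcal{H}_k(c\xi)=c^k\mathcal{H}_k(\xi)\text{ for }c\in\mathbb{R}.$$ Let $R$ be the curvature tensor of $g$, with sign convention $R(x,y,z,w)=g\big((\nabla_x\nabla_y-\nabla_y\nabla_x-\nabla_{[x,y]})z,w\big)$, so that $R(x,y,y,x)>0$ for linearly independent $x,y$ on the round sphere. Let $\mathcal{J}_k(\xi)$ be the endomorphism of $T_PM$ defined by $$g(\mathcal{J}_k(\xi)\eta_1,\eta_2)=(\nabla^kR)(\eta_1,\xi,\xi,\eta_2;\xi,\dots,\xi),$$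 so $\mathcal{J}_0(\xi)$ is the Jacobi operator. It is known that $\mathcal{H}_n(\xi)$ is given by a universal formula (with coefficients independent of the manifold, the point, and the dimension) as a linear combination of products of traces of products of the operators $\mathcal{J}_{k}(\xi)$, where each term involves operators $\mathcal{J}_{k_1}(\xi),\dots,\mathcal{J}_{k_\ell}(\xi)$ with $\sum_i(k_i+2)=n$. The term with $\ell=1$ is $c_n\operatorname{Tr}\{\mathcal{J}_{n-2}(\xi)\}$. The ''lower order terms'' are the terms with $\ell\ge2$. For example, $$\mathcal{H}_2(\xi)=-\tfrac16\operatorname{Tr}\{\mathcal{J}_0(\xi)\},\quad \mathcal{H}_4(\xi)=\tfrac1{72}\operatorname{Tr}\{\mathcal{J}_0(\xi)\}^2-\tfrac1{180}\operatorname{Tr}\{\mathcal{J}_0(\xi)^2\}-\tfrac1{40}\operatorname{Tr}\{\mathcal{J}_2(\xi)\}.$$ *)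

(* Defs.v *)
From HB Require Import structures.
From mathcomp Require Import all_boot all_order all_algebra.
From mathcomp Require Import all_classical all_reals all_analysis.
Set Implicit Arguments.
Unset Strict Implicit.
Unset Printing Implicit Defensive.
Import Order.TTheory GRing.Theory Num.Theory.
Import numFieldNormedType.Exports.
Local Open Scope classical_set_scope.
Local Open Scope ring_scope.

(* Vectors are rows: a matrix [A] acts as a linear map by [v |-> v *m A], in
   agreement with [jacobian], and the Gram matrix [A] of a bilinear form gives
   [u *m A *m v^T].  The norm carried by ['rV_m] is the sup norm, hence the
   separate [enorm]. *)

Section Smoothness.
Context {R : realType} {m : nat} {V : normedModType R}.

Fixpoint Ck_on (k : nat) (U : set 'rV[R]_m) (f : 'rV[R]_m -> V) : Prop :=
  match k with
  | 0 => {in U, continuous f}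
  | k'.+1 => forall v : 'rV[R]_m,
      (forall x, U x -> derivable f x v) /\ Ck_on k' U (fun x => 'D_v f x)
  end.

Definition smooth_on (U : set 'rV[R]_m) (f : 'rV[R]_m -> V) : Prop :=
  forall k, Ck_on k U f.

End Smoothness.

Section LocalGeometry.
Context {R : realType} {m : nat}.
Implicit Types (G : 'rV[R]_m -> 'M[R]_m) (x u v xi : 'rV[R]_m).

Definition enorm xi : R := Num.sqrt (\sum_(i < m) xi 0 i ^+ 2).

Definition bil (A : 'M[R]_m) u v : R := (u *m A *m v^T) 0 0.

Definition frame (i : 'I_m) : 'rV[R]_m := delta_mx 0 i.

(* [christoffel G x u v] is the vector Gamma^k_{ij}(x) u^i v^j. *)
Definition christoffel G x u v : 'rV[R]_m :=
  (\row_(l < m) (2^-1 *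
     ('D_u (fun y => bil (G y) v (frame l)) x
      + 'D_v (fun y => bil (G y) u (frame l)) x
      - 'D_(frame l) (fun y => bil (G y) u v) x)))
  *m invmx (G x).

Definition nabla G (X Y : 'rV[R]_m -> 'rV[R]_m) : 'rV[R]_m -> 'rV[R]_m :=
  fun x => 'D_(X x) Y x + christoffel G x (X x) (Y x).

Definition lie_bracket (X Y : 'rV[R]_m -> 'rV[R]_m) : 'rV[R]_m -> 'rV[R]_m :=
  fun x => 'D_(X x) Y x - 'D_(Y x) X x.

Definition curvature_op G (X Y Z : 'rV[R]_m -> 'rV[R]_m) (x : 'rV[R]_m) :
    'rV[R]_m :=
  nabla G X (nabla G Y Z) x - nabla G Y (nabla G X Z) x
  - nabla G (lie_bracket X Y) Z x.

(* A covariant tensor field [T] is given by the functions [x |-> T us x], its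
   value at [x] on the vectors with constant components [us] (one vector per
   slot; the value on a list of the wrong length is irrelevant). *)
Definition tensor_field := seq 'rV[R]_m -> 'rV[R]_m -> R.

Definition riemann G : tensor_field := fun us p =>
  if us is [:: x; y; z; w]
  then bil (G p) (curvature_op G (cst x) (cst y) (cst z) p) w else 0.

(* The new, differentiation slot comes first rather than last. *)
Definition cov_deriv G (T : tensor_field) : tensor_field := fun us x =>
  if us is v :: ws
  then 'D_v (T ws) x
       - \sum_(p < size ws)
           T (set_nth 0 ws p (christoffel G x v (nth 0 ws p))) x
  else 0.

Definition nablaR G (k : nat) : tensor_field := iter k (cov_deriv G) (riemann G).

(* The matrix of J_k(xi) at the origin in the coordinate basis, acting on
   columns of components: g(J_k(xi) eta1, eta2) is
   (nabla^k R)(eta1, xi, xi, eta2; xi, ..., xi). *)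
Definition jacobi G (k : nat) xi : 'M[R]_m :=
  invmx (G 0) *m
  \matrix_(i < m, j < m)
    nablaR G k (nseq k xi ++ [:: frame j; xi; xi; frame i]) 0.

Definition volume_density_tilde G xi : R := Num.sqrt (\det (G xi)).

Definition volume_density G xi : R :=
  enorm xi ^+ m.-1 * volume_density_tilde G xi.

(* [Theta(xi) ~ |xi|^(m-1) (1 + sum_(k >= 2) H_k(xi))] at the origin. *)
Definition asymptotic_expansion
    (Theta : 'rV[R]_m -> R) (H : nat -> 'rV[R]_m -> R) : Prop :=
  (forall (k : nat) (a : R) xi, (2 <= k)%N -> H k (a *: xi) = a ^+ k * H k xi)
  /\ (forall (N : nat) (e : R), 0 < e ->
        \forall xi \near (0 : 'rV[R]_m),
          `|Theta xi - enorm xi ^+ m.-1 * (1 + \sum_(2 <= k < N.+1) H k xi)|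
          <= e * enorm xi ^+ (m.-1 + N)).

(* For [w = [:: s_1; ...; s_p]], the product over [i] of the trace of the
   product of the [J k] for [k] in [s_i]. *)
Definition trace_monomial (J : nat -> 'M[R]_m) (w : seq (seq nat)) : R :=
  \prod_(s <- w) \tr (\big[mulmx/1%:M]_(k <- s) J k).

End LocalGeometry.

Section Manifolds.
Context {R : realType}.

Record chart (m : nat) (M : topologicalType) := Chart {
  cdom : set M;
  cmap : M -> 'rV[R]_m;
  cinv : 'rV[R]_m -> M;
  cdom_open : open cdom;
  crange_open : open (cmap @` cdom);
  cmapK : {in cdom, cancel cmap cinv};
  cmap_continuous : {in cdom, continuous cmap};
  cinv_continuous : {in cmap @` cdom, continuous cinv}
}.

Definition crange m (M : topologicalType) (a : chart m M) : set 'rV[R]_m :=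
  cmap a @` cdom a.

Definition transition m (M : topologicalType) (a b : chart m M) :
  'rV[R]_m -> 'rV[R]_m := cmap b \o cinv a.

Definition overlap m (M : topologicalType) (a b : chart m M) : set 'rV[R]_m :=
  cmap a @` (cdom a `&` cdom b).

Definition compatible m (M : topologicalType) (a b : chart m M) : Prop :=
  smooth_on (overlap a b) (transition a b) /\
  smooth_on (overlap b a) (transition b a).

(* [atlas] need not be maximal.  [gram a x] is the matrix of the g_{ij} in the
   chart [a] at the point with coordinates [x]; it is meaningful for [a] in
   [atlas] and [x] in [crange a]. *)
Record riemannian_manifold (m : nat) := RiemannianManifold {
  carrier :> topologicalType;
  carrier_hausdorff : hausdorff_space carrier;
  carrier_second_countable : @second_countable carrier;
  atlas : set (chart m carrier);
  chart_at : carrier -> chart m carrier;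
  chart_at_atlas : forall p, atlas (chart_at p);
  chart_at_dom : forall p, cdom (chart_at p) p;
  atlas_compatible : forall a b, atlas a -> atlas b -> compatible a b;
  gram : chart m carrier -> 'rV[R]_m -> 'M[R]_m;
  gram_smooth : forall a, atlas a -> smooth_on (crange a) (gram a);
  gram_sym : forall a x, atlas a -> crange a x -> (gram a x)^T = gram a x;
  gram_pos : forall a x v,
    atlas a -> crange a x -> v != 0 -> 0 < bil (gram a x) v v;
  gram_change : forall a b x, atlas a -> atlas b -> overlap a b x ->
    gram a x = jacobian (transition a b) x
               *m gram b (transition a b x)
               *m (jacobian (transition a b) x)^T
}.

(* The matrix of the g_{ij} in a chart [c] that is compatible with the atlas
   but need not belong to it. *)
Definition coord_metric m (M : riemannian_manifold m) (c : chart m M) :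
    'rV[R]_m -> 'M[R]_m := fun x =>
  let b := chart_at (cinv c x) in
  jacobian (transition c b) x
  *m gram b (transition c b x)
  *m (jacobian (transition c b) x)^T.

Definition is_geodesic m (M : riemannian_manifold m) (t0 t1 : R)
    (gamma : R -> M) : Prop :=
  forall t, t0 < t < t1 ->
    {for t, continuous gamma} /\
    forall a : chart m M, atlas a -> cdom a (gamma t) ->
      let u : R -> 'rV[R]_m := cmap a \o gamma in
      [/\ \forall s \near t, derivable u s 1,
          derivable (derive1 u) t 1
        & derive1 (derive1 u) t
          + christoffel (gram a) (u t) (derive1 u t) (derive1 u t) = 0].

(* [exp_at P v q] : exp_P(v) is defined and equal to [q], where the tangent
   vector [v] at [P] is given by its components in [chart_at P]. *)
Definition exp_at m (M : riemannian_manifold m) (P : M) (v : 'rV[R]_m)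
    (q : M) : Prop :=
  exists (gamma : R -> M) (e : R),
    [/\ 0 < e, is_geodesic (- e) (1 + e) gamma, gamma 0 = P,
        derive1 (cmap (chart_at P) \o gamma : R -> 'rV[R]_m) 0 = v
      & gamma 1 = q].

(* The rows of [E] are the components, in [chart_at P], of the vectors of a
   basis of the tangent space at [P]. *)
Definition orthonormal_frame m (M : riemannian_manifold m) (P : M)
    (E : 'M[R]_m) : Prop :=
  E *m gram (chart_at P) (cmap (chart_at P) P) *m E^T = 1%:M.

Definition geodesic_coordinates m (M : riemannian_manifold m) (P : M)
    (c : chart m M) : Prop :=
  [/\ forall a, atlas a -> compatible c a,
      cdom c P,
      cmap c P = 0
    & exists2 E : 'M[R]_m, orthonormal_frame P E &
        forall xi, crange c xi -> exp_at P (xi *m E) (cinv c xi)].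

(* Index of a trace monomial of weight [n] in at least two operators.  Empty
   traces, which would produce the dimension, are excluded. *)
Definition lower_order (n : nat) (w : seq (seq nat)) : bool :=
  [&& all (fun s => s != [::]) w,
      (2 <= size (flatten w))%N
    & (\sum_(k <- flatten w) (k + 2) == n)%N].

(* H_n = c Tr J_(n-2) + lower order terms, the latter being listed in [L] with
   their coefficients, for all Riemannian manifolds of all dimensions >= 2. *)
Definition universal_expression (n : nat) (c : R) (L : seq (R * seq (seq nat)))
    : Prop :=
  all (fun t => lower_order n t.2) L /\
  forall (m : nat) (M : riemannian_manifold m) (P : M) (x : chart m M)
         (H : nat -> 'rV[R]_m -> R),
    (2 <= m)%N ->
    geodesic_coordinates P x ->
    asymptotic_expansion (volume_density (coord_metric x)) H ->
    forall xi : 'rV[R]_m,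
      H n xi =
        c * \tr (jacobi (coord_metric x) (n - 2) xi)
        + \sum_(t <- L)
            t.1 * trace_monomial
                    (fun k => jacobi (coord_metric x) k xi) t.2.

End Manifolds.

(* Main.v *)
(* The coefficient [c_n] can be read off a single surface.  Writing [n = N + 2],
   take on R^2 the metric which in polar coordinates is
   [dr^2 + r^2 (1 + u + u^2)^2 dtheta^2], with [u = (x^2 + y^2) x^N] homogeneous of
   degree [n].  Rays from the origin are geodesics, so the Cartesian coordinates are
   geodesic coordinates, and the volume density is [r (1 + u + u^2)]: hence
   [H_n = u].  The metric is flat up to terms of order [n], so [J_k(0) = 0] for
   [k < N]; all lower order terms then vanish, since each contains such a factor.
   At [xi = (1, 0)] the only nonzero entry of [J_N] comes from the N-th derivative at 0 of
   [- f''/f] with [f = t (1 + t^n + t^(2n))], that is [- n (n + 1) N!]; therefore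
   [1 = - c_n n (n + 1) (n - 2)!]. *)
From HB Require Import structures.
Require Import Defs.
From mathcomp Require Import all_boot all_order all_algebra.
From mathcomp Require Import all_classical all_reals all_analysis.
From mathcomp Require Import ring lra zify.
Set Implicit Arguments.
Unset Strict Implicit.
Unset Printing Implicit Defensive.
Import Order.TTheory GRing.Theory Num.Theory.
Import numFieldNormedType.Exports.
Local Open Scope ring_scope.

(** * Calculus of smooth maps on row vectors *)

Section Derive.
Local Open Scope classical_set_scope.
Context {R : realType} (U V : normedModType R).

Lemma is_derive_scalel (f : U -> R) (a : V) x v df :
  is_derive x v f df -> is_derive x v (fun y => f y *: a) (df *: a).
Proof.
move=> [fxv <-].
have c : (fun h => h^-1 *: (((fun y => f y *: a) \o shift x) (h *: v)
    - (fun y => f y *: a) x)) @ 0^' --> 'D_v f x *: a.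
  under eq_fun do rewrite /= -scalerBl scalerA.
  by apply: cvgZr_tmp; exact: fxv.
by split; [apply/cvg_ex; exists ('D_v f x *: a)|exact: cvg_lim c].
Qed.

End Derive.

Section Smooth.
Local Open Scope classical_set_scope.
Context {R : realType} {m : nat}.
Implicit Types V : normedModType R.

Lemma smooth_derivable V (f : 'rV[R]_m -> V) x v :
  smooth_on setT f -> derivable f x v.
Proof. by move=> /(_ 1%N) /(_ v) [+ _]; apply. Qed.

Lemma smooth_derive V (f : 'rV[R]_m -> V) v :
  smooth_on setT f -> smooth_on setT ('D_v f).
Proof. by move=> sf k; have [_] := sf k.+1 v. Qed.

Lemma smooth_continuous V (f : 'rV[R]_m -> V) :
  smooth_on setT f -> continuous f.
Proof. by move=> /(_ 0%N) cf x; apply: cf; rewrite inE. Qed.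

Lemma smooth_cst V (a : V) : smooth_on setT (cst a : 'rV[R]_m -> V).
Proof.
move=> k; elim: k a => [|k IH] a /=; first by move=> x _; exact: cst_continuous.
move=> v; split; first by move=> x _; exact: derivable_cst.
rewrite (_ : (fun x => _) = cst 0); first exact: IH.
by apply/funext => x; exact: derive_cst.
Qed.

Lemma Ck_onD V k (f g : 'rV[R]_m -> V) :
  Ck_on k setT f -> Ck_on k setT g -> Ck_on k setT (f + g).
Proof.
elim: k f g => [|k IH] f g /= cf cg.
  by move=> x xT; apply: continuousD; [exact: cf|exact: cg].
move=> v; split.
  by move=> x xT; apply: derivableD; [apply: (cf v).1|apply: (cg v).1].
rewrite (_ : (fun x => _) = 'D_v f + 'D_v g).
  by apply: IH; [apply: (cf v).2|apply: (cg v).2].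
by apply/funext => x; apply: deriveD; [apply: (cf v).1|apply: (cg v).1].
Qed.

Lemma smoothD V (f g : 'rV[R]_m -> V) :
  smooth_on setT f -> smooth_on setT g -> smooth_on setT (f + g).
Proof. by move=> sf sg k; apply: Ck_onD. Qed.

(** The induction assumes both factors smooth rather than of class [k]: the Leibniz rule brings back
    the undifferentiated factors one order lower, and [Ck_on k.+1] does not contain [Ck_on k] by
    definition. *)
Lemma smoothM (f g : 'rV[R]_m -> R) :
  smooth_on setT f -> smooth_on setT g -> smooth_on setT (f * g).
Proof.
move=> + + k; elim: k f g => [|k IH] f g sf sg /=.
  by move=> x _; apply: continuousM; exact: smooth_continuous.
move=> v; split.
  by move=> x _; apply: derivableM; exact: smooth_derivable.
rewrite (_ : (fun x => _) = f * 'D_v g + g * 'D_v f).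
  by apply: Ck_onD; apply: IH => //; exact: smooth_derive.
by apply/funext => x; apply: deriveM; exact: smooth_derivable.
Qed.

Lemma smoothX (f : 'rV[R]_m -> R) n :
  smooth_on setT f -> smooth_on setT (f ^+ n).
Proof.
move=> sf; elim: n => [|n IH]; first exact: smooth_cst.
by rewrite exprS; exact: smoothM.
Qed.

Lemma smooth_scalel V (f : 'rV[R]_m -> R) (a : V) :
  smooth_on setT f -> smooth_on setT (fun x => f x *: a).
Proof.
move=> + k; elim: k f => [|k IH] f sf /=.
  by move=> x _; apply: continuousZr_tmp; exact: smooth_continuous.
have d x v : is_derive x v (fun y => f y *: a) ('D_v f x *: a).
  by apply: is_derive_scalel; apply: derivableP; exact: smooth_derivable.
move=> v; split; first by move=> x _; case: (d x v).
rewrite (_ : (fun x => _) = fun x => 'D_v f x *: a).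
  by apply: IH; exact: smooth_derive.
by apply/funext => x; case: (d x v).
Qed.

Lemma smooth_sum V n (f : 'I_n -> 'rV[R]_m -> V) :
  (forall i, smooth_on setT (f i)) -> smooth_on setT (\sum_(i < n) f i).
Proof.
by move=> sf; elim/big_ind : _ => [|? ? ? ?|//];
  [exact: smooth_cst|exact: smoothD].
Qed.

(** The difference quotient equals [f v] for every nonzero [h], so no continuity of [f] is
    required. *)
Lemma is_derive_linear V (f : {linear 'rV[R]_m -> V}) x v :
  is_derive x v f (f v).
Proof.
have c : (fun h => h^-1 *: ((f \o shift x) (h *: v) - f x)) @ 0^' --> f v.
  apply: cvg_near_cst; near=> h.
  rewrite /= -linearB /= addrK linearZ /= scalerA mulVf ?scale1r//.
  by near: h; exact: nbhs_dnbhs_neq.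
by split; [apply/cvg_ex; exists (f v)|exact: cvg_lim c].
Unshelve. all: by end_near. Qed.

Lemma smooth_linear V (f : {linear 'rV[R]_m -> V}) :
  continuous f -> smooth_on setT f.
Proof.
move=> cf [|k] /=; first by move=> x _; exact: cf.
move=> v; split; first by move=> x _; case: (is_derive_linear f x v).
rewrite (_ : (fun x => _) = cst (f v)); first exact: smooth_cst.
by apply/funext => x; case: (is_derive_linear f x v).
Qed.

End Smooth.

Section MatrixValued.
Local Open Scope classical_set_scope.
Context {R : realType} {m : nat}.

Lemma smooth_coord (i : 'I_m) :
  smooth_on setT (fun x : 'rV[R]_m => x 0 i : R).
Proof.
have lf : linear (fun x : 'rV[R]_m => x 0 i : R).
  by move=> c x y; rewrite !mxE.
pose f : {linear 'rV[R]_m -> R} :=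
  HB.pack (fun x : 'rV[R]_m => x 0 i : R) (GRing.isLinear.Build _ _ _ _ _ lf).
exact: (@smooth_linear _ _ _ f (@coord_continuous R 1 m 0 i)).
Qed.

Lemma is_derive_coord (i : 'I_m) (x v : 'rV[R]_m) :
  is_derive x v (fun x : 'rV[R]_m => x 0 i : R) (v 0 i).
Proof.
have lf : linear (fun x : 'rV[R]_m => x 0 i : R).
  by move=> c y z; rewrite !mxE.
pose f : {linear 'rV[R]_m -> R} :=
  HB.pack (fun x : 'rV[R]_m => x 0 i : R) (GRing.isLinear.Build _ _ _ _ _ lf).
exact: (is_derive_linear f).
Qed.

(** Expansion in the matrix units reduces smoothness of a matrix-valued map to that of its scalar
    entries. *)
Lemma fun_mx_sum_delta p q (F : 'rV[R]_m -> 'M[R]_(p, q)) :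
  F = \sum_(i < p) \sum_(j < q) fun x => F x i j *: delta_mx i j.
Proof.
apply/funext => x; rewrite fct_sumE {1}[F x]matrix_sum_delta.
by apply: eq_bigr => i _; rewrite fct_sumE.
Qed.

Lemma smooth_mx p q (F : 'rV[R]_m -> 'M[R]_(p, q)) :
  (forall i j, smooth_on setT (fun x => F x i j)) -> smooth_on setT F.
Proof.
move=> sF; rewrite (fun_mx_sum_delta F).
by apply: smooth_sum => i; apply: smooth_sum => j; apply: smooth_scalel.
Qed.

Lemma continuous_mx p q (F : 'rV[R]_m -> 'M[R]_(p, q)) x :
  (forall i j, {for x, continuous (fun x => F x i j)}) ->
  {for x, continuous F}.
Proof.
move=> cF A [P nP PA].
have nij i j : \forall y \near x, P i j (F y i j) by exact: cF (nP i j).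
have ni i : \forall y \near x, forall j, P i j (F y i j).
  exact: filter_forall (nij i).
have nF : \forall y \near x, forall i j, P i j (F y i j).
  exact: filter_forall ni.
have sA : (fun y => forall i j, P i j (F y i j)) `<=` F @^-1` A.
  by move=> y; exact: PA.
exact: filterS sA nF.
Qed.

End MatrixValued.

(** * Cross product, squared norm and quarter turn in the plane *)

Section Cross.
Local Open Scope classical_set_scope.
Context {R : realType}.
Implicit Types a b u v x y : 'rV[R]_2.

Lemma sum2 (V : nmodType) (F : 'I_2 -> V) : \sum_(i < 2) F i = F 0 + F 1.
Proof.
by rewrite big_ord_recl big_ord1; congr (_ + F _); apply: val_inj.
Qed.

Lemma forall_ord2 (P : 'I_2 -> Prop) : P 0 -> P 1 -> forall i, P i.
Proof.
move=> P0 P1 [[|[|//]] i2].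
  by rewrite (_ : Ordinal i2 = 0) //; apply: val_inj.
by rewrite (_ : Ordinal i2 = 1) //; apply: val_inj.
Qed.

Definition cross a b : R := a 0 0 * b 0 1 - a 0 1 * b 0 0.

Definition sqnorm x : R := x 0 0 ^+ 2 + x 0 1 ^+ 2.

(** The quarter turn of [x]: its dot product with [a] is [cross x a], so [(perp x)^T *m perp x] is
    the Gram matrix of the form $r^4 d\theta^2$ at [x]. *)
Definition perp x : 'rV[R]_2 := \row_j (if j == 0 then - x 0 1 else x 0 0).

Lemma is_derive_cross a x v : is_derive x v (fun y => cross y a) (cross v a).
Proof.
have := is_deriveB (is_derive_scalel (a 0 1) (is_derive_coord 0 x v))
   (is_derive_scalel (a 0 0) (is_derive_coord 1 x v)).
by apply.
Qed.

Lemma smooth_cross a : smooth_on setT (fun y : 'rV[R]_2 => cross y a).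
Proof.
rewrite (_ : (fun _ => _) = (fun y : 'rV[R]_2 => y 0 0 *: a 0 1)
    + (fun y : 'rV[R]_2 => y 0 1 *: (- a 0 0))).
  by apply: smoothD; apply: smooth_scalel; exact: smooth_coord.
by apply/funext => x; rewrite /cross -mulrN.
Qed.

Lemma smooth_perp j : smooth_on setT (fun x : 'rV[R]_2 => perp x 0 j).
Proof.
elim/forall_ord2 : j.
  rewrite (_ : (fun _ => _) = fun x : 'rV[R]_2 => x 0 1 *: (-1)).
    by apply: smooth_scalel; exact: smooth_coord.
  by apply/funext => x; rewrite mxE [RHS]mulrN1.
rewrite (_ : (fun _ => _) = fun x : 'rV[R]_2 => x 0 0).
  exact: smooth_coord.
by apply/funext => x; rewrite mxE.
Qed.

Lemma smooth_sqnorm : smooth_on setT (sqnorm : 'rV[R]_2 -> R).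
Proof.
rewrite (_ : sqnorm = (fun x : 'rV[R]_2 => x 0 0) ^+ 2
    + (fun x : 'rV[R]_2 => x 0 1) ^+ 2).
  by apply: smoothD; apply: smoothX; exact: smooth_coord.
by apply/funext => x; rewrite /sqnorm !expr2.
Qed.

Lemma cross_antisym a b : cross b a = - cross a b.
Proof. by rewrite /cross; ring. Qed.

End Cross.

(** * Rank-one perturbations of the flat metric: positivity, inverse, Christoffel symbols *)

Section Metric.
Local Open Scope classical_set_scope.
Context {R : realType} (psi : 'rV[R]_2 -> R).
Implicit Types a b u v x y : 'rV[R]_2.

(* In polar coordinates this is [dr^2 + (r^2 + r^4 psi) dtheta^2]. *)
Definition radial_gram x : 'M[R]_2 := 1%:M + psi x *: ((perp x)^T *m perp x).

Lemma bil_radial_gram x a b : bil (radial_gram x) a b =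
  a 0 0 * b 0 0 + a 0 1 * b 0 1 + psi x * (cross x a * cross x b).
Proof.
rewrite /bil mxE sum2 !mxE !sum2 !mxE !big_ord1 !mxE /cross /=.
by rewrite !mulr1n !mulr0n; ring.
Qed.

Lemma radial_gram0 : radial_gram 0 = 1%:M.
Proof.
apply/matrixP => i j; rewrite 4!mxE big_ord1 !mxE.
by rewrite oppr0 if_same mul0r mulr0 addr0.
Qed.

Lemma radial_gram_sym x : (radial_gram x)^T = radial_gram x.
Proof.
by rewrite /radial_gram linearD linearZ /= trmx_mul trmxK tr_scalar_mx.
Qed.

(** The determinant of a rank-one update of the identity, with [sqnorm (perp x) = sqnorm x]. *)
Lemma det_radial_gram x : \det (radial_gram x) = 1 + sqnorm x * psi x.
Proof.
rewrite (expand_det_row _ 0) sum2 /cofactor !det_mx11 !mxE !big_ord1 !mxE /=.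
by rewrite addn0 add0n expr0 expr1 /sqnorm; ring.
Qed.

Context (psi_smooth : smooth_on setT psi).

Lemma smooth_radial_gram : smooth_on setT radial_gram.
Proof.
apply: smooth_mx => i j.
rewrite (_ : (fun _ => _) = cst ((i == j)%:R)
    + psi * ((fun x => perp x 0 i) * (fun x => perp x 0 j))).
  by apply: smoothD; [exact: smooth_cst|do 2?apply: smoothM => //; exact: smooth_perp].
by apply/funext => x; rewrite 4!mxE big_ord1 [(perp x)^T _ _]mxE.
Qed.

Lemma derive_radial_gram x v a b :
  'D_v (fun y => bil (radial_gram y) a b) x =
  'D_v psi x * (cross x a * cross x b)
  + psi x * (cross v a * cross x b + cross x a * cross v b).
Proof.
rewrite (_ : (fun _ => _) = cst (a 0 0 * b 0 0 + a 0 1 * b 0 1)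
    + psi * ((cross^~ a) * (cross^~ b))); last first.
  by apply/funext => y; rewrite bil_radial_gram.
have dpsi : is_derive x v psi ('D_v psi x).
  by apply: derivableP; exact: smooth_derivable.
have da := is_derive_cross a x v; have db := is_derive_cross b x v.
rewrite derive_val add0r /= /GRing.scale /=.
by rewrite -[(_ * _) x]/(cross x a * cross x b); ring.
Qed.

(** Christoffel symbols of the first kind, before the index is raised by the inverse Gram matrix. *)
Definition lowered x u v : 'rV[R]_2 := \row_l
  (2^-1 * ('D_u psi x * (cross x v * cross x (frame l))
           + 'D_v psi x * (cross x u * cross x (frame l))
           - 'D_(frame l) psi x * (cross x u * cross x v))
   + psi x * (cross x v * cross u (frame l) + cross x u * cross v (frame l))).

(** In the terms carrying an undifferentiated [psi], antisymmetry of [cross] cancels the two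
    multiples of [cross u v] and doubles the others, which absorbs the factor one half. *)
Lemma christoffel_lowered x u v :
  christoffel radial_gram x u v = lowered x u v *m invmx (radial_gram x).
Proof.
congr (_ *m _); apply/rowP => l; rewrite !mxE !derive_radial_gram.
by rewrite (cross_antisym u v) (cross_antisym u (frame l))
  (cross_antisym v (frame l)); field.
Qed.

Context (psi_pos : forall x, 0 < 1 + sqnorm x * psi x).

Lemma radial_gram_unit x : radial_gram x \in unitmx.
Proof. by rewrite unitmxE det_radial_gram unitfE gt_eqF. Qed.

(** Only [psi x < 0] is delicate. There Lagrange's identity bounds [cross x v ^+ 2] by
    [sqnorm x * sqnorm v], so the form is at least [sqnorm v * (1 + sqnorm x * psi x)]. *)
Lemma radial_gram_pos x v : v != 0 -> 0 < bil (radial_gram x) v v.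
Proof.
move=> v0; rewrite bil_radial_gram -!expr2.
have v_gt0 : 0 < sqnorm v.
  rewrite lt_neqAle addr_ge0 ?sqr_ge0 // andbT eq_sym.
  rewrite paddr_eq0 ?sqr_ge0 // !sqrf_eq0; apply: contra v0 => /andP[/eqP v0 /eqP v1].
  by apply/eqP/rowP; elim/forall_ord2; rewrite mxE.
have := psi_pos x; have [psi0 _|psi0 q0] := leP 0 (psi x).
  by rewrite ltr_pwDl // mulr_ge0 // sqr_ge0.
have lagrange : cross x v ^+ 2 <= sqnorm x * sqnorm v.
  rewrite -subr_ge0 (_ : _ - _ = (x 0 0 * v 0 0 + x 0 1 * v 0 1) ^+ 2).
    exact: sqr_ge0.
  by rewrite /sqnorm /cross; ring.
apply: (lt_le_trans (mulr_gt0 v_gt0 q0)).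
rewrite mulrDr mulr1 lerD2l (_ : sqnorm v * _ = psi x * (sqnorm x * sqnorm v)).
  exact: (ler_wnM2l (ltW psi0) lagrange).
by ring.
Qed.

(** Lets a Christoffel vector be verified by lowering its index, without inverting the Gram
    matrix. *)
Lemma christoffelP x u v w :
  w *m radial_gram x = lowered x u v -> christoffel radial_gram x u v = w.
Proof. by move=> wE; rewrite christoffel_lowered -wE mulmxK ?radial_gram_unit. Qed.

(** Each term of [lowered] contains [cross x u] or [cross x v]. This is what makes the rays from the
    origin geodesics. *)
Lemma christoffel_radial x u v : cross x u = 0 -> cross x v = 0 ->
  christoffel radial_gram x u v = 0.
Proof.
move=> xu xv; apply: christoffelP; rewrite mul0mx.
by apply/rowP => l; rewrite !mxE xu xv; ring.
Qed.

Lemma christoffel0l x v : christoffel radial_gram x 0 v = 0.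
Proof.
apply: christoffelP; rewrite mul0mx; apply/rowP => l.
by rewrite !mxE derive0 /cross !mxE; ring.
Qed.

Lemma christoffelC x u v :
  christoffel radial_gram x u v = christoffel radial_gram x v u.
Proof.
rewrite !christoffel_lowered; congr (_ *m _); apply/rowP => l; rewrite !mxE.
by ring.
Qed.

(** The Sherman-Morrison inverse; its explicit entries give continuity in [x]. *)
Definition radial_gram_inv x : 'M[R]_2 :=
  1%:M - (psi x / (1 + sqnorm x * psi x)) *: ((perp x)^T *m perp x).

Lemma invmx_radial_gram x : invmx (radial_gram x) = radial_gram_inv x.
Proof.
have q0 : 1 + sqnorm x * psi x != 0 by rewrite gt_eqF.
suff e : radial_gram_inv x *m radial_gram x = 1%:M.
  by rewrite -[LHS]mul1mx -e mulmxK ?radial_gram_unit.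
apply/matrixP; elim/forall_ord2; elim/forall_ord2;
  rewrite !mxE !sum2 !mxE !big_ord1 !mxE /= /sqnorm in q0 *; by field.
Qed.

Lemma continuous_radial_gram_inv i j :
  continuous (fun x => radial_gram_inv x i j).
Proof.
pose q : 'rV[R]_2 -> R := cst 1 + sqnorm * psi.
pose f : 'rV[R]_2 -> R := psi * ((fun x => perp x 0 i) * (fun x => perp x 0 j)).
have -> : (fun x => radial_gram_inv x i j) =
    cst ((i == j)%:R) - f * (fun x => (q x)^-1).
  apply/funext => x; rewrite 5!mxE big_ord1 [(perp x)^T _ _]mxE.
  congr (_ - _); rewrite mulrAC; congr (_ * _).
have cq : continuous q.
  apply: smooth_continuous; apply: smoothD; first exact: smooth_cst.
  by apply: smoothM; first exact: smooth_sqnorm.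
have cf : continuous f.
  apply: smooth_continuous; apply: smoothM => //.
  by apply: smoothM; exact: smooth_perp.
move=> x; apply: continuousB; first exact: cst_continuous.
apply: continuousM; first exact: cf.
by apply: continuousV; [rewrite gt_eqF ?psi_pos|exact: cq].
Qed.

End Metric.

(** * One-variable calculus on a line through the origin *)

Section Line.
Context {R : realType} {m : nat} (V : normedModType R).

Lemma derive_along_line (f : 'rV[R]_m -> V) x t c :
  'D_(c *: x) f (t *: x) = 'D_c (fun s : R => f (s *: x)) t.
Proof.
rewrite /derive; set F := fun h => _; set G := fun h => _.
suff -> : F = G by [].
by apply/funext => h; rewrite /F /G /= scalerA -scalerDl.
Qed.

(** Only derivability at [x] in the direction [v] is assumed, so the argument passes to
    [h |-> f (h *: v + x)]: in one variable, derivability gives differentiability, hence a linear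
    differential. *)
Lemma derive_scale_dir (f : 'rV[R]_m -> V) x v (c : R) :
  derivable f x v -> 'D_(c *: v) f x = c *: 'D_v f x.
Proof.
move=> /derivable1P/derivable1_diffP; set g := fun h : R => _ => dg.
have gE (z : R) : 'D_(z *: v) f x = 'D_z g 0.
  rewrite /derive; set F := fun h => _; set F' := fun h => _.
  suff -> : F = F' by [].
  by apply/funext => h; rewrite /F /F' /g /= scalerA addr0 scale0r add0r.
rewrite gE -[v in RHS]scale1r gE !deriveE //.
by rewrite -[in LHS](mulr1 c) -[c * 1]/(c *: 1) linearZ.
Qed.

(** A derivative along the line sees only the restriction to the line, so knowing a field on the ray
    suffices to differentiate it there in the radial direction. *)
Lemma derive_on_line (f : 'rV[R]_m -> V) (g : R -> V) x (t c : R) dg :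
  (forall s, f (s *: x) = g s) -> is_derive t (1 : R) g dg ->
  'D_(c *: x) f (t *: x) = c *: dg.
Proof.
move=> fg [g1 <-]; rewrite derive_along_line (funext fg).
have dg' : differentiable g t by apply/derivable1_diffP.
by rewrite !deriveE // -[in LHS](mulr1 c) -[c * 1]/(c *: 1) linearZ.
Qed.

End Line.

Section HornerDiv.
Context {R : realType}.

Lemma is_derive_horner_div (P Q : {poly R}) (t : R) : Q.[t] != 0 ->
  is_derive t (1 : R) (fun s => P.[s] / Q.[s])
    ((P^`() * Q - P * Q^`()).[t] / Q.[t] ^+ 2).
Proof.
move=> Q0.
have dP := is_derive_poly P t; have dQ := is_derive_poly Q t.
have dV := is_deriveV Q0 dQ.
apply: (is_derive_eq (is_deriveM dP dV)).
by rewrite !hornerE /GRing.scale /=; field.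
Qed.

End HornerDiv.

(** * Curvature and its covariant derivatives along the first coordinate axis *)

Section Ray.
Context {R : realType} (psi : 'rV[R]_2 -> R) (p Q : {poly R}).
Implicit Types a b u v x y : 'rV[R]_2.
Context (psi_smooth : smooth_on [set: _]%classic psi).
Context (psi_pos : forall x, 0 < 1 + sqnorm x * psi x).
Context (psi_ray : forall t, psi (t *: frame 0) = p.[t]).
Context (pQ : 1 + 'X^2 * p = Q ^+ 2).

Local Notation G := (radial_gram psi).
Local Notation xi := (frame 0 : 'rV[R]_2).
(** On the ray the volume density [volume_density_tilde] is the absolute value of [Q], and [alpha]
    is its logarithmic derivative. *)
Local Notation alpha t := (Q^`().[t] / Q.[t]).

Lemma frameE (i j : 'I_2) : frame i 0 j = (j == i)%:R :> R.
Proof. by rewrite mxE. Qed.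

Lemma sqnorm_ray t : sqnorm (t *: xi) = t ^+ 2.
Proof. by rewrite /sqnorm !mxE /=; ring. Qed.

Lemma density_sqr_ray t : 1 + t ^+ 2 * p.[t] = Q.[t] ^+ 2.
Proof. by rewrite -horner_exp -pQ !hornerE. Qed.

Lemma density_ray_neq0 t : Q.[t] != 0.
Proof.
have := psi_pos (t *: xi); rewrite sqnorm_ray psi_ray density_sqr_ray.
by rewrite lt_neqAle eq_sym sqrf_eq0 => /andP[].
Qed.

(** Half the derivative of the identity [pQ]; it rewrites the [psi] terms of the Christoffel symbols
    through $Q Q'$. *)
Lemma density_deriv_ray t :
  Q.[t] * Q^`().[t] = t * p.[t] + 2^-1 * (t ^+ 2 * p^`().[t]).
Proof.
have := congr1 (fun q : {poly R} => q^`().[t]) pQ.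
rewrite derivD derivC add0r derivM derivXn expr2 derivM.
rewrite !hornerD !hornerM !(hornerXn, hornerMn, hornerX) /= => e.
have {}e : 2 * (Q.[t] * Q^`().[t]) = t *+ 2 * p.[t] + t ^+ 2 * p^`().[t].
  by rewrite e; ring.
rewrite -[LHS](mulKf (_ : 2 != 0 :> R)) ?pnatr_eq0 // e.
by rewrite mulrDr -[t *+ 2]mulr_natl -mulrA mulKf ?pnatr_eq0.
Qed.

Lemma cross_ray t a : cross (t *: xi) a = t * a 0 1.
Proof. by rewrite /cross !mxE /=; ring. Qed.

Lemma derive_psi_ray t c : 'D_(c *: xi) psi (t *: xi) = c * p^`().[t].
Proof. exact: (derive_on_line _ psi_ray (is_derive_poly p t)). Qed.

Lemma frame1_gram_ray t : frame 1 *m G (t *: xi) = Q.[t] ^+ 2 *: frame 1.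
Proof.
rewrite -density_sqr_ray -psi_ray; apply/rowP; elim/forall_ord2;
  by rewrite !mxE sum2 !mxE !big_ord1 !mxE /=; ring.
Qed.

(** With one argument radial, [lowered] is a multiple of [frame 1], an eigenvector of the Gram
    matrix on the ray with eigenvalue $Q^2$. Dividing $Q Q'$ by $Q^2$ leaves [alpha]. *)
Lemma christoffel_ray t c a :
  christoffel G (t *: xi) (c *: xi) a = (c * a 0 1 * alpha t) *: frame 1.
Proof.
apply: christoffelP => //; rewrite -scalemxAl frame1_gram_ray.
apply/rowP => l; rewrite !mxE derive_psi_ray !cross_ray psi_ray !mxE /= /cross.
rewrite !mxE [_ == l]eq_sym.
have -> (z : R) : z * (Q^`().[t] / Q.[t]) * (Q.[t] ^+ 2 * (l == 1)%:R)
    = z * (l == 1)%:R * (Q.[t] * Q^`().[t]).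
  by field; exact: density_ray_neq0.
by rewrite density_deriv_ray; ring.
Qed.

Lemma bil_frame1_ray t c b :
  bil (G (t *: xi)) (c *: frame 1) b = c * b 0 1 * Q.[t] ^+ 2.
Proof.
rewrite /bil -scalemxAl frame1_gram_ray !mxE sum2 !mxE /=.
by ring.
Qed.

(* [christoffel G y xi xi] vanishes on the ray: this is its quotient by the
   transverse coordinate, so that its derivatives on the ray need only the
   continuity of [transverse]. *)
Definition transverse y : 'rV[R]_2 := - (\row_l
  ('D_xi psi y * cross y (frame l) + 2^-1 * ('D_(frame l) psi y * y 0 1)
   + 2 * psi y * cross xi (frame l)) *m radial_gram_inv psi y).

Lemma christoffel_transverse y c d :
  christoffel G y (c *: xi) (d *: xi) = (c * d * y 0 1) *: transverse y.
Proof.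
rewrite christoffel_lowered // /transverse -invmx_radial_gram //.
rewrite -mulNmx scalemxAl; congr (_ *m _); apply/rowP => l; rewrite !mxE.
have dZ z : 'D_(z *: xi) psi y = z * 'D_xi psi y.
  by apply: derive_scale_dir; exact: smooth_derivable.
rewrite !dZ.
have cZ z : cross y (z *: xi) = - z * y 0 1.
  by rewrite /cross !mxE /=; ring.
have cZl z : cross (z *: xi) (frame l) = z * cross xi (frame l).
  by rewrite /cross !mxE /=; ring.
rewrite !cZ !cZl.
by field.
Qed.

Lemma frame1_inv_ray t :
  frame 1 *m radial_gram_inv psi (t *: xi) = Q.[t] ^- 2 *: frame 1.
Proof.
rewrite -invmx_radial_gram //.
apply: (canLR (mulmxK (radial_gram_unit psi_pos (t *: xi)))).
by rewrite /= -scalemxAl frame1_gram_ray scalerA mulVf ?scale1r // expf_neq0 ?density_ray_neq0.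
Qed.

Lemma transverse_ray t : transverse (t *: xi) =
  - ((t * p^`().[t] + 2 * p.[t]) / Q.[t] ^+ 2) *: frame 1.
Proof.
rewrite /transverse (_ : \row_l _ = (t * p^`().[t] + 2 * p.[t]) *: frame 1).
  by rewrite -scalemxAl frame1_inv_ray scalerA scaleNr.
have := derive_psi_ray t 1; rewrite scale1r mul1r => dp.
apply/rowP => l; rewrite !mxE cross_ray psi_ray dp /cross !mxE /= [_ == l]eq_sym.
by ring.
Qed.

Lemma transverse_continuous : continuous transverse.
Proof.
move=> x; apply: continuous_mx => i j; rewrite {i}ord1.
pose N (l : 'I_2) : 'rV[R]_2 -> R := 'D_xi psi * (cross^~ (frame l))
  + (cst 2^-1 * ('D_(frame l) psi * (fun y => y 0 1))
     + cst 2 * psi * cst (cross xi (frame l))).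
have cN l : continuous (N l).
  apply: smooth_continuous; apply: smoothD.
    by apply: smoothM; [exact: smooth_derive|exact: smooth_cross].
  apply: smoothD.
    apply: smoothM; first exact: smooth_cst.
    by apply: smoothM; [exact: smooth_derive|exact: smooth_coord].
  by do 2?apply: smoothM => //; exact: smooth_cst.
have -> : (fun y => transverse y 0 j) =
    - (N 0 * (fun y => radial_gram_inv psi y 0 j)
       + N 1 * (fun y => radial_gram_inv psi y 1 j)).
  apply/funext => y; rewrite mxE [(_ *m _) _ _]mxE sum2.
  by rewrite ![(\row_l _) _ _]mxE -!addrA.
apply: continuousN; apply: continuousD; apply: continuousM.
all: by [exact: cN|exact: continuous_radial_gram_inv].
Qed.

(** The Christoffel vector vanishes on the ray and the transverse coordinate of [h *: a + t *: xi]
    is [h * a 0 1]. The difference quotient is therefore a constant times [transverse] at that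
    point, and continuity gives the limit. *)
Lemma derive_transverse t a c d :
  'D_a (fun y => christoffel G y (c *: xi) (d *: xi)) (t *: xi)
  = (c * d * a 0 1) *: transverse (t *: xi).
Proof.
have cT : {for 0, continuous (fun h : R => transverse (h *: a + t *: xi))}.
  apply: continuous_comp; last exact: transverse_continuous.
  by apply: cvgD; [exact: scalel_continuous|exact: cvg_cst].
apply: cvg_lim => //.
apply: (@cvg_trans _ ((fun h : R =>
    (c * d * a 0 1) *: transverse (h *: a + t *: xi)) @ 0^'%classic)%classic).
  apply: near_eq_cvg; near=> h.
  rewrite /= !christoffel_transverse !mxE /= !mulr0 addr0 scale0r subr0 scalerA.
  have h0 : h != 0 by near: h; exact: nbhs_dnbhs_neq.
  by congr (_ *: _); field.
apply: cvgZl_tmp; have := (continuous_withinNx _ _).1 cT.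
by rewrite /= scale0r add0r.
Unshelve. all: by end_near. Qed.

Lemma nabla_cst u v :
  nabla G (cst u) (cst v) = fun q => christoffel G q u v.
Proof. by apply/funext => q; rewrite /nabla derive_cst add0r. Qed.

Lemma christoffel_ray_tangent t c d :
  christoffel G (t *: xi) (c *: xi) (d *: xi) = 0.
Proof. by rewrite christoffel_ray !mxE /= !mulr0 mul0r scale0r. Qed.

(** Since $t (2p + t p') = 2 Q Q'$, for nonzero $t$ the bracketed quotient with its sign is $-f''/f$
    with $f = t Q$, the Gauss curvature. Writing it with [p] keeps it meaningful at $t = 0$. *)
Lemma curvature_ray t a c d :
  curvature_op G (cst a) (cst (c *: xi)) (cst (d *: xi)) (t *: xi) =
  (c * d * a 0 1 * - ((t * p^`().[t] + 2 * p.[t] + Q^`()^`().[t] * Q.[t])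
    / Q.[t] ^+ 2)) *: frame 1.
Proof.
have lie0 : lie_bracket (cst a) (cst (c *: xi)) (t *: xi) = 0.
  by rewrite /lie_bracket !derive_cst subrr.
rewrite /curvature_op !nabla_cst /nabla lie0 derive0 christoffel0l // addr0 subr0.
rewrite derive_transverse transverse_ray christoffel_ray_tangent.
rewrite (christoffelC psi_smooth (t *: xi) (cst a _)) christoffel0l // addr0.
have christoffel_flip s : christoffel G (s *: xi) a (d *: xi)
    = (d * a 0 1 * alpha s) *: frame 1.
  by rewrite christoffelC ?christoffel_ray.
(* The term $Q'^2$ in the derivative of [alpha] cancels against $\alpha^2$, which comes from the
   nested Christoffel vector. *)
have dalpha : is_derive t (1 : R) (fun s => (d * a 0 1 * alpha s) *: frame 1)
    ((d * a 0 1 * ((Q^`()^`() * Q - Q^`() * Q^`()).[t] / Q.[t] ^+ 2))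
     *: (frame 1 : 'rV[R]_2)).
  apply: is_derive_scalel; apply: (is_derive_eq (is_deriveM (is_derive_cst _ _ _)
    (is_derive_horner_div Q^`() (density_ray_neq0 t)))).
  by rewrite scaler0 addr0.
rewrite /cst (derive_on_line _ christoffel_flip dalpha) christoffel_flip.
rewrite christoffel_ray.
rewrite !scalerA -scalerDl -scalerBl; congr (_ *: _).
rewrite !mxE /= !(hornerD, hornerN, hornerM); field.
exact: density_ray_neq0.
Qed.

(** The [k] differentiation slots come first, so the four curvature slots are [k] to [k.+3] and the
    outer two are read transversally. *)
Definition weight k i (v : 'rV[R]_2) : R :=
  if (i == k) || (i == k.+3) then v 0 1 else v 0 0.

(* The class of tensors along the ray [t xi] that [cov_deriv] preserves: all slots
   but the k-th and the (k+3)-th, which are those of [eta1] and [eta2] in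
   [nabla^k R], are restricted to multiples of [xi]. *)
Definition ray_tensor k (T : @tensor_field R 2) (S : R -> R) :=
  forall (us : seq 'rV[R]_2) (t : R), size us = k.+4 ->
    (forall i, (i < k.+4)%N -> i != k -> i != k.+3 -> nth 0 us i 0 1 = 0) ->
    T us (t *: xi) = S t * \prod_(i < k.+4) weight k i (nth 0 us i).

Lemma eq_scale_xi (v : 'rV[R]_2) : v 0 1 = 0 -> v = v 0 0 *: xi.
Proof.
by move=> v1; apply/rowP; elim/forall_ord2; rewrite !mxE ?v1 /= ?mulr1 ?mulr0.
Qed.

(** Pairing with [frame 1] contributes $Q^2$, which clears the denominator of the curvature. *)
Lemma ray_tensor_riemann : ray_tensor 0 (riemann G)
  (fun t => - (t * p^`().[t] + 2 * p.[t] + Q^`()^`().[t] * Q.[t])).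
Proof.
move=> [|a [|u [|v [|b [|//]]]]] // t _ us0.
have /eq_scale_xi uE : u 0 1 = 0 by exact: (us0 1%N).
have /eq_scale_xi vE : v 0 1 = 0 by exact: (us0 2%N).
rewrite /riemann {1}uE {1}vE curvature_ray bil_frame1_ray.
rewrite !big_ord_recl big_ord0 /weight /=.
by field; exact: density_ray_neq0.
Qed.

(** A correction in a radial slot vanishes, because the Christoffel vector of two radial vectors is
    zero on the ray. In each of the two transverse slots it multiplies the transverse component by
    [v 0 0 * alpha t]; hence the coefficient 2. *)
Lemma ray_tensor_cov_deriv k (T : @tensor_field R 2) (S dS : R -> R) :
  (forall t : R, is_derive t (1 : R) S (dS t)) ->
  ray_tensor k T S ->
  ray_tensor k.+1 (cov_deriv G T) (fun t => dS t - 2 * alpha t * S t).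
Proof.
move=> dS_ TS [|v us] // t [szu] us0.
have v1 : v 0 1 = 0 by exact: (us0 0%N).
have us1 i : (i < k.+4)%N -> i != k -> i != k.+3 -> nth 0 us i 0 1 = 0.
  by move=> ik ik0 ik3; apply: (us0 i.+1); rewrite ?ltnS ?eqSS.
(* The new slot 0 is radial and gives the factor [v 0 0]; the shifted remaining slots give the
   product [W] of the old tensor. *)
rewrite /cov_deriv szu big_ord_recl.
set W := \prod_(i < k.+4) weight k i (nth 0 us i).
rewrite -[X in _ = _ * (_ * X)]/W.
rewrite /= /weight /= {1}(eq_scale_xi v1).
have Tline s : T us (s *: xi) = S s *: W by exact: TS.
rewrite (derive_on_line _ Tline (is_derive_scalel W (dS_ t))).
have term (i : 'I_k.+4) :
    T (set_nth 0 us i (christoffel G (t *: xi) v (nth 0 us i))) (t *: xi)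
    = if (i == k :> nat) || (i == k.+3 :> nat) then v 0 0 * alpha t * S t * W
      else 0.
  set w := christoffel _ _ _ _.
  have wE : w = (v 0 0 * nth 0 us i 0 1 * alpha t) *: frame 1.
    by rewrite /w {1}(eq_scale_xi v1) christoffel_ray.
  rewrite TS.
  - rewrite /W (bigD1 i) // [in RHS](bigD1 i) //= nth_set_nth /= eqxx.
    rewrite (eq_bigr (fun j : 'I_k.+4 => weight k j (nth 0 us j))) => [|j ji].
      rewrite {1 3}/weight wE !mxE /=; case: ifP => _; last by rewrite mulr0 mul0r mulr0.
      by ring.
    by rewrite nth_set_nth /= (inj_eq val_inj) (negPf ji).
  - by rewrite size_set_nth szu; apply/maxn_idPr.
  - move=> j jk jk0 jk3; rewrite nth_set_nth /=; case: eqP => [ji|_]; last exact: us1.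
    by rewrite wE (us1 i) // ?mulr0 ?mul0r ?scale0r ?mxE // -ji.
rewrite (eq_bigr _ (fun i _ => term i)) !big_ord_recr /= big1 => [|i _].
  rewrite !eqxx orbT /= (_ : (k.+1 == k) = false); last by lia.
  rewrite (_ : (k.+1 == k.+3) = false); last by lia.
  rewrite (_ : (k.+2 == k) = false); last by lia.
  rewrite (_ : (k.+2 == k.+3) = false); last by lia.
  by rewrite /= /GRing.scale /=; ring.
have ik := ltn_ord i.
by rewrite (ltn_eqF ik) (ltn_eqF (leqW (leqW (leqW ik)))).
Qed.

(* With [S_k] the coefficient of [nabla^k R] along the ray, [S_(k+1)] is
   [S_k' - 2 (Q'/Q) S_k], and [S_k = ray_numerator k / Q^k]. *)
Fixpoint ray_numerator k : {poly R} :=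
  if k is k'.+1 then
    (ray_numerator k')^`() * Q - k'.+2%:R *: (ray_numerator k' * Q^`())
  else - ('X * p^`() + 2 *: p + Q^`()^`() * Q).

Lemma ray_tensor_nablaR k :
  ray_tensor k (nablaR G k) (fun t => (ray_numerator k).[t] / Q.[t] ^+ k).
Proof.
elim: k => [|k IH].
  move=> us t szu us0; rewrite expr0 divr1 /= !hornerE /=.
  exact: ray_tensor_riemann.
have dS (t : R) : is_derive t (1 : R) (fun s => (ray_numerator k).[s] / Q.[s] ^+ k)
   (((ray_numerator k)^`().[t] * Q.[t] - k%:R * (ray_numerator k).[t] * Q^`().[t])
     / Q.[t] ^+ k.+1).
  have Q0 := density_ray_neq0 t.
  have Qk0 : (Q ^+ k).[t] != 0 by rewrite horner_exp expf_neq0.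
  have := is_derive_horner_div (ray_numerator k) Qk0.
  under eq_fun do rewrite horner_exp.
  move/is_derive_eq; apply.
  rewrite deriv_exp !(hornerD, hornerN, hornerM, hornerMn, horner_exp).
  (* The derivative of [Q ^+ k] involves the exponent [k.-1], so [k = 0] is separate. *)
  case: k {IH Qk0} => [|k] /=; first by field.
  by rewrite -mulr_natl !exprS; field; rewrite Q0 expf_neq0.
move=> us t szu us0; rewrite [nablaR _ _]iterS.
rewrite (ray_tensor_cov_deriv dS IH) //; congr (_ * _).
rewrite /= !(hornerD, hornerN, hornerM, hornerZ) !exprS.
by field; rewrite density_ray_neq0 expf_neq0 ?density_ray_neq0.
Qed.

(** At [t = 0] the Gram matrix is the identity, every slot filled with [xi] has weight 1, and the
    two transverse slots select the entry [(1, 1)]. *)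
Lemma jacobi_ray k : jacobi G k xi =
  ((ray_numerator k).[0] / Q.[0] ^+ k) *: delta_mx 1 1.
Proof.
rewrite /jacobi radial_gram0 invmx1 mul1mx; apply/matrixP => i j; rewrite !mxE.
set us := nseq k xi ++ _.
have usE (l : nat) : nth 0 us (k + l) = nth 0 [:: frame j; xi; xi; frame i] l.
  by rewrite nth_cat size_nseq ltnNge leq_addr /= addKn.
have usk l : (l < k)%N -> nth 0 us l = xi.
  by move=> lk; rewrite nth_cat size_nseq lk nth_nseq lk.
have := @ray_tensor_nablaR k us 0; rewrite scale0r => ->.
- congr (_ * _).
  rewrite !big_ord_recr /= big1 => [|l _]; last first.
    have lk := ltn_ord l.
    rewrite /weight (ltn_eqF lk) (ltn_eqF (leqW (leqW (leqW lk)))) /=.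
    by rewrite usk // frameE.
  have := usE 0%N; have := usE 1%N; have := usE 2%N; have := usE 3%N.
  rewrite addn0 addn1 addn2 addn3 => -> -> -> -> /=.
  rewrite /weight !eqxx orbT /= (_ : (k.+1 == k) = false); last by lia.
  rewrite (_ : (k.+1 == k.+3) = false); last by lia.
  rewrite (_ : (k.+2 == k) = false); last by lia.
  rewrite (_ : (k.+2 == k.+3) = false) /=; last by lia.
  by rewrite !frameE !eqxx !mul1r !mulr1 -natrM mulnb andbC ![_ == 1]eq_sym.
- by rewrite size_cat size_nseq addn4.
move=> l lk; have [lk'|] := ltnP l k; first by rewrite usk // frameE.
move=> kl; rewrite -(subnKC kl) usE; case: (l - k)%N => [|[|[|[|l']]]] //=.
- by rewrite addn0 eqxx.
- by rewrite frameE.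
- by rewrite frameE.
- by rewrite addn3 eqxx.
(* Past the end of the list, [nth] returns the zero vector, whose components vanish. *)
by rewrite nth_nil mxE.
Qed.

End Ray.

(** * Order of vanishing and leading coefficient of the numerators at 0 *)

Section RayNumerator.
Context {R : realType} (N : nat) (a b p Q : {poly R}).
Context (a0 : a.[0] = 2).
Context (b0 : b.[0] = 1).

Context (pE : p = 'X^N * a).
Context (QE : Q = 1 + 'X^(N.+2) * b).

(** For [k = 0] the leading coefficient is $-(2N + 4 + (N+1)(N+2)) = -(N+2)(N+3)$. Each recursion
    step lowers the order by one and multiplies this coefficient by $N - k$; the term with $Q'$, of
    order at least $N+1$, does not affect it. *)
Lemma ray_numerator_order k : (k <= N)%N ->
  exists2 r : {poly R}, ray_numerator p Q k = 'X^(N - k) * r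
    & r.[0] = - (N.+2 * N.+3 * N ^_ k)%:R.
Proof.
have Q0 : Q.[0] = 1 by rewrite QE hornerD hornerM hornerXn exprS !mul0r addr0 hornerE.
(* The extra factor ['X] avoids the exponent [m.-1], so that [N = 0] is covered. *)
have XdX m : 'X * ('X^m : {poly R})^`() = m%:R * 'X^m.
  by case: m => [|m]; rewrite derivXn ?mulr0 ?mul0r //= -mulr_natl mulrCA -exprS.
elim: k => [_|k IH kN].
  pose c m : {poly R} := (m%:R)%:P.
  have dX m : ('X^(m.+1) : {poly R})^`() = c m.+1 * 'X^m.
    by rewrite derivXn /= /c polyC_natr mulr_natl.
  have dQ : Q^`() = 'X^(N.+1) * (c N.+2 * b + 'X * b^`()).
    by rewrite QE derivD derivC add0r derivM dX !exprS; ring.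
  have ddQ : Q^`()^`() = 'X^N * (c N.+1 * (c N.+2 * b + 'X * b^`())
      + c N.+2 * 'X * b^`() + 'X * ('X * b^`()^`()) + 'X * b^`()).
    by rewrite dQ derivM dX derivD !derivM derivX !derivC !exprS; ring.
  exists (- (c N * a + 'X * a^`() + c 2 * a
     + (c N.+1 * (c N.+2 * b + 'X * b^`()) + c N.+2 * 'X * b^`()
        + 'X * ('X * b^`()^`()) + 'X * b^`()) * Q)).
    rewrite subn0 /= ddQ pE derivM mulrDr [_ * (_^`() * a)]mulrA XdX.
    rewrite -mul_polyC /c polyC_natr; ring.
  rewrite !(hornerN, hornerD, hornerM, hornerX, hornerC).
  rewrite a0 b0 Q0 ffactn0 muln1 natrM -!natr1; ring.
have [r rE r0] := IH (ltnW kN).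
(* What remains of the recursion applied to ['X^(N - k) * r] once ['X^(N - k.+1)] is factored
   out. *)
exists ((N - k)%:R * r * Q + 'X * r^`() * Q - k.+2%:R * ('X * r * Q^`())).
  rewrite /= rE derivM -(subnSK kN) derivXn /= -mul_polyC polyC_natr exprS.
  by rewrite -[_ *+ _]mulr_natl; ring.
rewrite !(hornerN, hornerD, hornerM, hornerX, hornerXn) -!polyC_natr !hornerC.
rewrite Q0 r0 ffactnSr [in RHS]mulnA natrM; ring.
Qed.

Lemma ray_numerator_low k : (k < N)%N -> (ray_numerator p Q k).[0] = 0.
Proof.
move=> kN; have [r -> _] := ray_numerator_order (ltnW kN).
by rewrite -(subnSK kN) !hornerE exprS !mul0r.
Qed.

Lemma ray_numerator_top :
  (ray_numerator p Q N).[0] = - (N.+2 * N.+3 * N`!)%:R.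
Proof.
have [r -> r0] := ray_numerator_order (leqnn N).
by rewrite subnn mul1r r0 ffactnn.
Qed.

End RayNumerator.

(** * Row vectors as a Riemannian manifold with one global chart *)

Section RowVectors.
Local Open Scope classical_set_scope.
Context {R : realType} (m : nat).

Lemma second_countable_rV : @second_countable 'rV[R]_m.
Proof.
pose B (q : 'rV[rat]_m * nat) : set 'rV[R]_m :=
  ball (map_mx ratr q.1 : 'rV[R]_m) q.2.+1%:R^-1.
exists (range B).
  exact: sub_countable (card_image_le _ _) (countableP _).
split=> [_ [q _ <-]|x A]; first exact: ball_open.
rewrite -nbhs_ballE => -[e /= e0 eA].
(* Two points of a ball of radius [k.+1%:R^-1] are less than [2 / k.+1] apart, so such a ball
   containing [x] lies in the [e]-ball around [x]. *)
pose k := Num.truncn (2 / e).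
have k0 : (0 : R) < k.+1%:R^-1 by rewrite invr_gt0 ltr0n.
have ke : k.+1%:R^-1 * 2 < e.
  rewrite mulrC ltr_pdivrMr ?ltr0n // mulrC -ltr_pdivrMr //.
  by rewrite /k truncnS_gt.
have dense (y : R) : {q : rat | ball (ratr q : R) k.+1%:R^-1 y}.
  apply: cid; have : y - k.+1%:R^-1 < y + k.+1%:R^-1.
    by rewrite ltrBlDr -addrA ltrDl addr_gt0.
  move=> /rat_in_itvoo[q]; rewrite in_itv /= => /andP[q1 q2]; exists q.
  rewrite /ball /= ltr_norml ltrBrDr addrC q1 /=; by rewrite ltrBlDl.
pose q : 'rV[rat]_m := \row_i sval (dense (x 0 i)).
have xB : B (q, k) x.
  split=> // i j; rewrite ord1 !mxE; exact: svalP (dense (x 0 j)).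
exists (B (q, k)); first by split => //; exists (q, k).
move=> y yB; apply: eA; apply: le_ball (ltW ke) _ _.
rewrite mulr_natr mulr2n; apply: ball_triangle yB; exact: ball_sym.
Qed.

Lemma jacobian_id (x : 'rV[R]_m) : jacobian id x = 1%:M.
Proof.
apply/row_matrixP => i; rewrite !rowE -deriveEjacobian; last exact: ex_diff.
by rewrite derive_id mulmx1.
Qed.

Lemma smooth_id : smooth_on setT (id : 'rV[R]_m -> 'rV[R]_m).
Proof. by apply: (@smooth_linear _ _ _ idfun) => x; exact: cvg_id. Qed.

Lemma open_image_id : open (id @` [set: 'rV[R]_m]).
Proof. by rewrite image_id; exact: openT. Qed.

(** Transparent, so that [cdom], [cmap] and [cinv] of this chart reduce. *)
Definition id_chart : @chart R m 'rV[R]_m.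
Proof.
refine (@Chart R m 'rV[R]_m setT id id openT open_image_id _ _ _) => //.
- by move=> x _; exact: cvg_id.
- by move=> x _; exact: cvg_id.
Defined.

Lemma overlap_id : overlap id_chart id_chart = setT.
Proof. by rewrite /overlap /= setIT image_id. Qed.

Lemma crange_id : crange id_chart = setT.
Proof. by rewrite /crange /= image_id. Qed.

Lemma compatible_id : compatible id_chart id_chart.
Proof. by rewrite /compatible overlap_id; split; exact: smooth_id. Qed.

Definition coordinate_manifold (G : 'rV[R]_m -> 'M[R]_m)
    (G_smooth : smooth_on setT G) (G_sym : forall x, (G x)^T = G x)
    (G_pos : forall x v, v != 0 -> 0 < bil (G x) v v) : @riemannian_manifold R m.
Proof.
refine (@RiemannianManifold R m 'rV[R]_m _ second_countable_rV [set id_chart]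
  (fun=> id_chart) _ _ _ (fun=> G) _ _ _ _) => //.
- by move=> a b -> ->; exact: compatible_id.
- by move=> a ->; rewrite crange_id.
- by move=> a x v _ _; exact: G_pos.
- by move=> a b x -> -> _; rewrite (jacobian_id x) trmx1 mul1mx mulmx1.
Defined.

End RowVectors.

(** * The model surface, its geodesic coordinates and its density expansion *)

Section Model.
Local Open Scope classical_set_scope.
Context {R : realType} (N : nat).
Implicit Types x : 'rV[R]_2.

Let u x : R := sqnorm x * x 0 0 ^+ N.

Definition model_density x : R := 1 + u x + u x ^+ 2.

(* Chosen to make [1 + |x|^2 psi] a square; the term [u ^+ 2] in [model_density]
   keeps it positive when [N] is odd. *)
Definition model_psi x : R :=
  x 0 0 ^+ N * (2 + 3 * u x + 2 * u x ^+ 2 + u x ^+ 3).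

Lemma model_density_sqr x : 1 + sqnorm x * model_psi x = model_density x ^+ 2.
Proof. by rewrite /model_psi /model_density /u; ring. Qed.

Lemma model_density_gt0 x : 0 < model_density x.
Proof. by rewrite /model_density; nra. Qed.

Lemma model_psi_pos x : 0 < 1 + sqnorm x * model_psi x.
Proof. by rewrite model_density_sqr exprn_gt0 // model_density_gt0. Qed.

Lemma smooth_model_psi : smooth_on setT model_psi.
Proof.
pose x0 : 'rV[R]_2 -> R := (fun x => x 0 0) ^+ N.
have sx0 : smooth_on setT x0 by apply: smoothX; exact: smooth_coord.
pose v : 'rV[R]_2 -> R := sqnorm * x0.
have sv : smooth_on setT v by apply: smoothM => //; exact: smooth_sqnorm.
have -> : model_psi = x0 * (cst 2 + cst 3 * v + cst 2 * v ^+ 2 + v ^+ 3).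
  have x0E x : x0 x = x 0 0 ^+ N by rewrite /x0 exprfctE.
  apply/funext => x; rewrite /model_psi -x0E /u -x0E.
  rewrite -[RHS]/(x0 x * (2 + 3 * (v x) + 2 * (v x * v x) + v x * (v x * v x))).
  by rewrite -[v x]/(sqnorm x * x0 x); ring.
apply: smoothM => //; apply: smoothD; last exact: smoothX.
apply: smoothD; last by apply: smoothM; [exact: smooth_cst|exact: smoothX].
apply: smoothD; first exact: smooth_cst.
by apply: smoothM; first exact: smooth_cst.
Qed.

(** On the ray [u] becomes ['X^(N.+2)]; [p] and [Q] are the restrictions of [model_psi] and
    [model_density]. *)
Let a : {poly R} :=
  2%:P + 3%:P * 'X^(N.+2) + 2%:P * 'X^(N.+2) ^+ 2 + 'X^(N.+2) ^+ 3.
Let b : {poly R} := 1 + 'X^(N.+2).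
Let p : {poly R} := 'X^N * a.
Let Q : {poly R} := 1 + 'X^(N.+2) * b.

Lemma model_psi_ray t : model_psi (t *: frame 0) = p.[t].
Proof.
rewrite /model_psi /u sqnorm_ray !mxE /= mulr1 /p /a.
have XN2 : ('X^(N.+2)).[t] = t ^+ 2 * t ^+ N by rewrite hornerXn -exprD.
have XN : ('X^N).[t] = t ^+ N by rewrite hornerXn.
move: ('X^(N.+2)) ('X^N) XN2 XN => z y zE yE.
by rewrite !(hornerD, hornerM, horner_exp, hornerC) zE yE; ring.
Qed.

Lemma model_density_sqr_ray : 1 + 'X^2 * p = Q ^+ 2.
Proof.
rewrite /p /Q /b /a !polyC_natr.
have -> : 'X^(N.+2) = 'X^2 * 'X^N :> {poly R} by rewrite -exprD.
by ring.
Qed.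

Local Notation G := (radial_gram model_psi).

Lemma jacobi_model k : jacobi G k (frame 0) =
  (ray_numerator p Q k).[0] *: delta_mx 1 1.
Proof.
have Q0 : Q.[0] = 1.
  by rewrite /Q hornerD hornerM hornerXn exprS !mul0r addr0 hornerE.
rewrite (jacobi_ray smooth_model_psi model_psi_pos model_psi_ray model_density_sqr_ray).
by rewrite Q0 expr1n divr1.
Qed.

Lemma model_b0 : b.[0] = 1.
Proof. by rewrite /b hornerD hornerXn exprS mul0r addr0 hornerE. Qed.

Lemma model_a0 : a.[0] = 2.
Proof.
have : ('X^(N.+2)).[0] = 0 :> R by rewrite hornerXn expr0n.
rewrite /a; move: ('X^(N.+2)) => z zE.
by rewrite !(hornerD, hornerM, horner_exp, hornerC) zE; ring.
Qed.

Lemma jacobi_model_low k : (k < N)%N -> jacobi G k (frame 0) = 0.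
Proof.
move=> kN; rewrite jacobi_model.
by rewrite (ray_numerator_low model_a0 model_b0 erefl erefl kN) scale0r.
Qed.

Lemma trace_jacobi_model :
  \tr (jacobi G N (frame 0)) = - (N.+2 * N.+3 * N`!)%:R.
Proof.
rewrite jacobi_model (ray_numerator_top model_a0 model_b0 erefl erefl).
by rewrite mxtraceZ /mxtrace sum2 !mxE /= add0r mulr1.
Qed.

Definition model_manifold : @riemannian_manifold R 2 :=
  coordinate_manifold (smooth_radial_gram smooth_model_psi)
    (radial_gram_sym model_psi) (radial_gram_pos model_psi_pos).

Lemma coord_metric_model :
  coord_metric (id_chart 2 : chart 2 model_manifold) = G.
Proof.
apply/funext => x; rewrite /coord_metric /=.
by rewrite (jacobian_id x) trmx1 mul1mx mulmx1.
Qed.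

Lemma geodesic_coordinates_model :
  geodesic_coordinates (0 : model_manifold) (id_chart 2).
Proof.
split=> //; first by move=> a' ->; exact: compatible_id.
exists 1%:M.
  by rewrite /orthonormal_frame /= mul1mx trmx1 mulmx1 radial_gram0.
move=> xi _; rewrite mulmx1.
have dgamma (t : R) : is_derive t (1 : R) (fun s : R => s *: xi) xi.
  have := is_derive_scalel xi (is_derive_id t (1 : R)).
  by rewrite scale1r.
have gamma' : derive1 (fun s : R => s *: xi) = cst xi.
  by apply/funext => t; rewrite derive1E; case: (dgamma t).
exists (fun t : R => t *: xi), 1; split=> //.
- move=> t _; split; first exact: scalel_continuous.
  move=> a' -> _ /=; rewrite gamma'; split.
  - apply: (filterS (P := setT)) => [s _|]; last exact: filterT.
    by case: (dgamma s).
  - exact: derivable_cst.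
  rewrite derive1_cst add0r.
  (* The velocity [xi] is parallel to the position [t *: xi], and the acceleration is zero. *)
  by apply: (christoffel_radial smooth_model_psi model_psi_pos);
    rewrite /cross !mxE; ring.
- exact: scale0r.
- by rewrite -[LHS]/(derive1 (fun s : R => s *: xi) 0) gamma'.
- exact: scale1r.
Qed.

(** The homogeneous components of [model_density] in positive degrees; there are only two of
    them. *)
Definition model_coef k x : R :=
  if k == N.+2 then u x else if k == N.+2.*2 then u x ^+ 2 else 0.

Lemma sum_model_coef M x : \sum_(2 <= k < M.+1) model_coef k x =
  (N.+2 <= M)%:R * u x + (N.+2.*2 <= M)%:R * u x ^+ 2.
Proof.
transitivity (\sum_(2 <= k < M.+1 | k == N.+2) u x
    + \sum_(2 <= k < M.+1 | k == N.+2.*2) u x ^+ 2).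
  rewrite [X in _ = X + _]big_mkcond [X in _ = _ + X]big_mkcond -big_split /=.
  apply: eq_bigr => k _; rewrite /model_coef; case: eqP => [->|_]; last by rewrite add0r.
  by rewrite (_ : (_ == _) = false) ?addr0 //; lia.
rewrite !big_nat1_eq !ltnS /=.
by do 2!case: leqP => _; rewrite ?mul1r ?mul0r.
Qed.

Lemma enorm_sqr x : enorm x ^+ 2 = sqnorm x.
Proof. by rewrite /enorm sqr_sqrtr sum2 // /sqnorm addr_ge0 ?sqr_ge0. Qed.

Lemma norm_u_le x : `|u x| <= enorm x ^+ N.+2.
Proof.
have x0r : `|x 0 0| <= enorm x.
  by rewrite -sqrtr_sqr ler_wsqrtr // sum2 lerDl sqr_ge0.
rewrite /u normrM -enorm_sqr normrX ger0_norm ?sqrtr_ge0 // normrX.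
rewrite -[N.+2]/(2 + N)%N exprD ler_wpM2l ?exprn_ge0 ?sqrtr_ge0 //.
by rewrite lerXn2r ?nnegrE ?sqrtr_ge0.
Qed.

Lemma volume_density_model x :
  volume_density G x = enorm x * model_density x.
Proof.
rewrite /volume_density expr1 /volume_density_tilde det_radial_gram.
by rewrite model_density_sqr sqrtr_sqr gtr0_norm // model_density_gt0.
Qed.

(** Truncation at [M] omits those of [u] and [u ^+ 2] whose degree exceeds [M]. For [enorm x <= 1]
    each is at most [enorm x ^+ M.+1] in absolute value. *)
Lemma asymptotic_expansion_model :
  asymptotic_expansion (volume_density G) model_coef.
Proof.
split=> [k c x _|M e e0].
  have uc : u (c *: x) = c ^+ N.+2 * u x.
    have -> : c ^+ N.+2 = c ^+ 2 * c ^+ N by rewrite -exprD.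
    by rewrite /u /sqnorm !mxE [(_ * _) ^+ N]exprMn; ring.
  rewrite /model_coef; case: eqP => [-> //|_]; case: eqP => [->|_].
    by rewrite uc exprMn -exprM muln2.
  by rewrite mulr0.
(* The bound 1 allows powers of the norm to be compared; the bound [e / 2] absorbs the two error
   terms. Smallness is stated for [sqnorm], whose continuity is at hand. *)
have : \forall x \near (0 : 'rV[R]_2), sqnorm x < Num.min 1 (e / 2) ^+ 2.
  have c0 : sqnorm (0 : 'rV[R]_2) < Num.min 1 (e / 2) ^+ 2.
    by rewrite /sqnorm !mxE expr0n addr0 exprn_gt0 // lt_min ltr01 divr_gt0.
  exact: cvgr_lt (smooth_continuous smooth_sqnorm (x := 0)) _ c0.
apply: filterS => x sx.
have r0 : 0 <= enorm x by exact: sqrtr_ge0.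
have : enorm x <= Num.min 1 (e / 2).
  have m0 : 0 <= Num.min 1 (e / 2) by rewrite le_min ler01 divr_ge0 // ltW.
  rewrite -(ler_pXn2r (n := 2)) ?nnegrE // enorm_sqr; exact: ltW.
rewrite le_min => /andP[r1 re].
rewrite volume_density_model !expr1 -mulrBr normrM ger0_norm // exprS.
rewrite mulrCA ler_wpM2l //.
have key : `|model_density x - (1 + \sum_(2 <= k < M.+1) model_coef k x)|
    <= enorm x ^+ M.+1 + enorm x ^+ M.+1.
  rewrite sum_model_coef (_ : _ - _ = (M < N.+2)%:R * u x + (M < N.+2.*2)%:R * u x ^+ 2).
    apply: le_trans (ler_normD _ _) _; apply: lerD; rewrite normrM.
      case: ltnP => MN; last by rewrite normr0 mul0r exprn_ge0.
      rewrite normr1 mul1r (le_trans (norm_u_le x)) //.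
      by rewrite ler_wiXn2l.
    case: ltnP => MN; last by rewrite normr0 mul0r exprn_ge0.
    rewrite normr1 mul1r normrX.
    apply: (@le_trans _ _ ((enorm x ^+ N.+2) ^+ 2)).
      by rewrite lerXn2r ?nnegrE ?exprn_ge0 ?norm_u_le.
    by rewrite -exprM muln2 ler_wiXn2l.
  rewrite !ltnNge /model_density; do 2!case: leqP => _ /=; ring.
apply: le_trans key _; rewrite exprS -mulrDl ler_wpM2r ?exprn_ge0 //.
by lra.
Qed.

End Model.

(** * Vanishing of the lower order terms and the value of the coefficient *)

Section LowerOrder.
Context {R : realType} {m : nat}.

(** The weights [k + 2] sum to [n], and there are at least two of them, all positive, so each is
    below [n]. The first operator of the first trace, which exists as traces are nonempty, is thus
    zero and annihilates the product. *)
Lemma trace_monomial_lower_order n (J : nat -> 'M[R]_m) w :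
  (forall k, (k + 2 < n)%N -> J k = 0) -> lower_order n w ->
  trace_monomial J w = 0.
Proof.
move=> J0; rewrite /trace_monomial /lower_order.
case: w => [|[|k s] w] /and3P[] //= _ kls /eqP sum_n.
rewrite big_cons big_cons J0 ?mul0mx ?mxtrace0 ?mul0r //.
case: (s ++ flatten w) kls sum_n => [|l r] // _; rewrite !big_cons => <-.
by lia.
Qed.

End LowerOrder.

Theorem lemma1p2 (R : realType) (n : nat) (c_n : R)
    (lower_terms : seq (R * seq (seq nat))) :
  (2 <= n)%N ->
  universal_expression n c_n lower_terms ->
  c_n = - ((n - 1)%:R / ((n + 1)`!)%:R).
Proof.
case: n => [|[|N]] // _ [/allP lower /(_ 2%N (model_manifold N) 0 (id_chart 2))].
move=> /(_ _ isT (@geodesic_coordinates_model R N)).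
rewrite coord_metric_model => /(_ _ (@asymptotic_expansion_model R N)).
move=> /(_ (frame 0)); rewrite !subSS !subn0 trace_jacobi_model.
rewrite big1_seq => [|[c w] /andP[_ /lower /= wn]]; last first.
  rewrite (trace_monomial_lower_order _ wn) ?mulr0 // => k kN.
  by apply: jacobi_model_low; lia.
(* At [frame 0] the function [u] equals 1, so the universal expression becomes $1 = -c_n A$ with $A
   = (N+2)(N+3) N!$. *)
rewrite addr0 /model_coef eqxx /sqnorm !mxE /= expr1n expr0n addr0 mul1r expr1n.
(* The factor [N.+1] is $n - 1$; it cancels the numerator of the claimed value. *)
have -> : (N.+2 + 1)`! = (N.+1 * (N.+2 * N.+3 * N`!))%N.
  by rewrite addn1 !factS; ring.
have : (N.+2 * N.+3 * N`!)%:R != 0 :> R.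
  by rewrite pnatr_eq0 -lt0n !muln_gt0 fact_gt0.
move: (N.+2 * N.+3 * N`!)%N => A A0 e.
rewrite natrM invfM mulrA divff ?pnatr_eq0 // mul1r.
by apply: (mulIf A0); rewrite mulNr mulVf // [in RHS]e mulrN opprK.
Qed.
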